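(* Let $X$ be a $\mathbb{Q}$-factorial projective toric variety over $\mathbb{C}$, let $\alpha\in\operatorname{Pic}X$ be a very ample class, and fix a non-zero $F\in H^0(X,\mathcal{O}(\alpha))^*$. Then: (1) if $\beta\in\operatorname{Cl}X$, then $\underline{\mathrm{r}}(F)\ge\operatorname{rank}(C_F^\beta)$; (2) if $\beta\in\operatorname{Pic}X$, then $\mathrm{cr}(F)\ge\operatorname{rank}(C_F^\beta)$. Here $\underline{\mathrm{r}}(F)$ and $\mathrm{cr}(F)$ denote the border rank and the cactus rank of $F$ with respect to $X\subseteq\mathbb{P}(H^0(X,\mathcal{O}(\alpha))^* )$ embedded by the complete linear system $|\mathcal{O}(\alpha)|$, and $C_F^\beta$ is the linear map $S_\beta\to T_{\alpha-\beta}$, $h\mapsto h\lrcorner F$.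
   Context: Let $\rho_1,\dots,\rho_r$ be the rays of the fan of $X$ and $D_{\rho_i}$ the corresponding torus-invariant prime divisors. The Cox ring of $X$ is $S=\mathbb{C}[x_1,\dots,x_r]$, graded by $\operatorname{Cl}X$ via $\deg x_i=[D_{\rho_i}]$, with $S_\beta\cong H^0(X,\mathcal{O}(\beta))$. Let $T=\mathbb{C}[y_1,\dots,y_r]$, graded by $\operatorname{Cl}X$ via $\deg y_i=[D_{\rho_i}]$. $T$ is an $S$-module through the contraction action $\lrcorner$ determined by: $x_i\lrcorner y_1^{b_1}\cdots y_r^{b_r}$ equals $y_1^{b_1}\cdots y_i^{b_i-1}\cdots y_r^{b_r}$ if $b_i>0$, and $0$ otherwise. The perfect pairing $S_\alpha\times T_\alpha\to T_0=\mathbb{C}$, $(g,F)\mapsto g\lrcorner F$, identifies $H^0(X,\mathcal{O}(\alpha))^*$ with $T_\alpha$. The action restricts to $S_\beta\times T_\alpha\to T_{\alpha-\beta}$. For a subvariety $X\subseteq\mathbb{P}W$ ($\mathbb{P}W$ being the space of lines in $W$) let $\sigma_l^0(X)$ be the set of points lying in the linear span $\langle p_1,\dots,p_l\rangle$ of some $p_1,\dots,p_l\in X$, and $\sigma_l(X)=\overline{\sigma_l^0(X)}$ (Zariski closure). For non-zero $F\in W$: the border rank is $\underline{\mathrm{r}}(F)=\min\{l\ge1: [F]\in\sigma_l(X)\}$; the cactus rank is $\mathrm{cr}(F)=\min\{\operatorname{length}R : R\hookrightarrow X \text{ closed subscheme},\ \dim R=0,\ [F]\in\langle R\rangle\}$,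 where $\operatorname{length}R=\dim_{\mathbb{C}}H^0(R,\mathcal{O}_R)$ and $\langle R\rangle$ is the smallest projective linear subspace of $\mathbb{P}W$ through which $R\hookrightarrow\mathbb{P}W$ factors. *)

(* Defs.v *)
From HB Require Import structures.
From mathcomp Require Import all_boot all_order all_algebra all_field.
From mathcomp Require Import finmap.
From mathcomp Require Import boolp classical_sets cardinality reals.
(* The notations of the extended reals are incompatible with those of mpoly. *)
From mathcomp Require Import -(notations) constructive_ereal ereal.
From mathcomp Require Import mpoly.
From mathcomp.real_closed Require Import complex.

Set Implicit Arguments.
Unset Strict Implicit.
Unset Printing Implicit Defensive.

Import Order.TTheory GRing.Theory Num.Theory.

Local Open Scope ring_scope.

(* W = K^k.  A subset of P(W) is given by a set Y of non-zero vectors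
   representing its points; all notions of this section depend only on the lines
   spanned by these vectors. *)

Section ProjectiveSpace.
Variables (R : realType) (K : fieldType) (k : nat).
Implicit Types (Y : set 'rV[K]_k) (v F : 'rV[K]_k).

Definition vanishes_on Y (f : {mpoly K[k]}) : Prop :=
  forall y, Y y -> f.@[y 0] = 0.

Definition zariski_closure Y : set 'rV[K]_k :=
  [set v : 'rV[K]_k | v != 0 /\
     forall (d : nat) (f : {mpoly K[k]}),
       f \is d.-homog -> vanishes_on Y f -> f.@[v 0] = 0]%classic.

Definition secant0 Y (l : nat) : set 'rV[K]_k :=
  [set v : 'rV[K]_k | v != 0 /\
     exists p : 'I_l -> 'rV[K]_k,
       (forall i, Y (p i)) /\ (v <= \matrix_(i < l) p i)%MS]%classic.

Definition secant Y (l : nat) : set 'rV[K]_k := zariski_closure (secant0 Y l).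

(* The minimum of a set of natural numbers, with value +oo on the empty set. *)
Definition nat_min (P : set nat) : extended R :=
  ereal_inf [set EFin l%:R | l in P]%classic.

Definition border_rank Y F : extended R :=
  nat_min [set l | (1 <= l)%N /\ secant Y l F]%classic.

(* A non-empty zero-dimensional closed subscheme Spec A of P(W) contained in
   the reduced closed subscheme with set of points Y.  Line bundles on the
   spectrum of a finite-dimensional algebra are trivial, so a morphism
   Spec A -> P(W) is given by homogeneous coordinates in A generating the unit
   ideal.  It is a closed immersion iff over every standard chart z_j <> 0 the
   map K[z_0/z_j, ..., z_(k-1)/z_j] -> A[1/w_j] is onto.  As A is
   Artinian, A -> A[1/w_j] is onto, so this means that every a in A becomes
   f(w) / w_j^d in A[1/w_j] for some form f of some degree d; after enlarging d
   the equality w_j^d a = f(w) holds in A itself. *)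
Record zero_dim_subscheme Y := ZeroDimSubscheme {
  zd_alg : falgType K;
  zd_comm : commutative (fun a b : zd_alg => a * b);
  zd_coord : 'I_k -> zd_alg;
  zd_unimodular : exists c : 'I_k -> zd_alg, \sum_i c i * zd_coord i = 1;
  zd_closed_immersion : forall (j : 'I_k) (a : zd_alg),
    exists (d : nat) (f : {mpoly K[k]}),
      f \is d.-homog /\
      mmap (GRing.in_alg zd_alg) zd_coord f = zd_coord j ^+ d * a;
  zd_subscheme : forall (d : nat) (f : {mpoly K[k]}),
    f \is d.-homog -> vanishes_on Y f ->
    mmap (GRing.in_alg zd_alg) zd_coord f = 0
}.

Definition zd_length Y (Z : zero_dim_subscheme Y) : nat :=
  \dim {: zd_alg Z}.

(* Z -> P(W) factors through P(L), L the row space of the matrix L: every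
   linear form vanishing on L vanishes on Z. *)
Definition zd_factors Y (Z : zero_dim_subscheme Y) (L : 'M[K]_k) : Prop :=
  forall c : 'cV[K]_k, L *m c = 0 -> \sum_i c i 0 *: zd_coord Z i = 0.

Definition zd_span Y (Z : zero_dim_subscheme Y) : set 'rV[K]_k :=
  [set v : 'rV[K]_k | v != 0 /\ forall L : 'M[K]_k, zd_factors Z L -> (v <= L)%MS]%classic.

(* The empty subscheme, excluded from [zero_dim_subscheme], has empty span. *)
Definition cactus_rank Y F : extended R :=
  nat_min [set l | exists Z : zero_dim_subscheme Y,
                     zd_length Z = l /\ zd_span Z F]%classic.

End ProjectiveSpace.

Section Cones.
Variables (R : realType) (n r : nat) (U : 'M[int]_(r, n)).

(* The rows of U are the ray generators u_i in N = Z^n. *)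
Definition ray_gen (i : 'I_r) : 'rV[R]_n := map_mx intr (row i U).

Definition cone (s : {set 'I_r}) : set 'rV[R]_n :=
  [set v | exists2 c : 'I_r -> R,
     (forall i, 0 <= c i) & v = \sum_(i in s) c i *: ray_gen i]%classic.

Definition pairing (m : 'rV[R]_n) (i : 'I_r) : R := (m *m (ray_gen i)^T) 0 0.

(* cone t is the face of cone s cut out by a linear form m >= 0 on cone s *)
Definition is_face (t s : {set 'I_r}) : Prop :=
  exists m : 'rV[R]_n,
    (forall i, i \in s -> 0 <= pairing m i) /\
    (forall i, (i \in t) = (i \in s) && (pairing m i == 0)).

End Cones.

Definition primitive_vector n (u : 'rV[int]_n) : Prop :=
  forall (k : int) (v : 'rV[int]_n), u = k *: v -> `|k| = 1.

(* A fan in N_R = R^n: each cone is recorded as the set of indices of its rays;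
   the fan need not be simplicial. *)
Record fan (R : realType) (n r : nat) := Fan {
  rays : 'M[int]_(r, n);
  cones : {set {set 'I_r}};
  rays_primitive : forall i, primitive_vector (row i rays);
  origin_cone : finset.set0 \in cones;
  ray_cone : forall i, finset.set1 i \in cones;
  cones_strongly_convex : forall s, s \in cones ->
    forall v : 'rV[R]_n, cone rays s v -> cone rays s (- v) -> v = 0;
  cones_face : forall s t, s \in cones -> is_face R rays t s -> t \in cones;
  cones_inter : forall s t, s \in cones -> t \in cones ->
    is_face R rays (s :&: t) s /\
    (cone (R := R) rays s `&` cone rays t = cone rays (s :&: t))%classic
}.

(* div(chi^m) = \sum_i <m, u_i> D_i *)
Definition div_character n r (U : 'M[int]_(r, n)) (m : 'rV[int]_n) :
  'rV[int]_r := m *m U^T.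

Definition principal n r (U : 'M[int]_(r, n)) : {pred 'rV[int]_r} :=
  fun a => `[< exists m, a = div_character U m >].

Lemma principal_zmod_closed n r (U : 'M[int]_(r, n)) :
  zmod_closed (principal U).
Proof.
split; first by apply/asboolP; exists 0; rewrite /div_character mul0mx.
move=> a b /asboolP[m ->] /asboolP[m' ->]; apply/asboolP.
by exists (m - m'); rewrite /div_character mulmxBl.
Qed.

HB.instance Definition _ n r (U : 'M[int]_(r, n)) :=
  GRing.isZmodClosed.Build _ (principal U) (principal_zmod_closed U).

Section ToricVariety.
Variables (R : realType) (n r : nat) (X : fan R n r).
Local Notation C := (complex R).
Local Notation U := (rays X).

(* Torus-invariant Weil divisors \sum_i a_i D_i are the a : 'rV[int]_r. *)
Definition Cl : zmodType := Quotient.quot (principal (rays X)).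

Definition div_class (a : 'rV[int]_r) : Cl := \pi_(Cl)%qT a.

(* Torus-invariant Cartier divisors are principal on each affine chart. *)
Definition cartier (a : 'rV[int]_r) : Prop :=
  forall s, s \in cones X ->
    exists m, forall i, i \in s -> a 0 i = div_character U m 0 i.

Definition Pic : set Cl :=
  [set alpha | exists2 a, cartier a & alpha = div_class a]%classic.

Definition Qfactorial : Prop :=
  forall alpha : Cl, exists2 k : nat, (0 < k)%N & Pic (alpha *+ k).

Definition mon_div (b : 'X_{1..r}) : 'rV[int]_r := \row_i (b i)%:Z.

Definition degree (b : 'X_{1..r}) : Cl := div_class (mon_div b).

(* The complete linear system of alpha has no base points (first clause) and
   defines a closed immersion (second clause): for each monomial section x^b of
   degree alpha, the open set X_b = {x^b <> 0} is affine, and the ratios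
   x^b' / x^b of sections generate its coordinate ring.  Here X_b is the toric
   variety of the subfan of the cones disjoint from the support of b, which is
   affine iff its rays span a cone of the fan; its coordinate ring has as basis
   the Laurent monomials x^c of degree 0 with c_i >= 0 for all i with b_i = 0,
   so generation amounts to each of them being a product of such ratios. *)
Definition very_ample (alpha : Cl) : Prop :=
  (forall s, s \in cones X ->
     exists2 b, degree b = alpha & forall i, i \in s -> b i = 0%N) /\
  (forall b, degree b = alpha ->
     [set i | b i == 0%N]%SET \in cones X /\
     forall c : 'rV[int]_r, c \in principal U ->
       (forall i, b i = 0%N -> 0 <= c 0 i) ->
       exists2 bs : seq 'X_{1..r},
         (forall b', b' \in bs -> degree b' = alpha) &
         c = \sum_(b' <- bs) (mon_div b' - mon_div b)).

Definition complete : Prop :=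
  forall v : 'rV[R]_n, exists2 s, s \in cones X & cone U s v.

Definition projective : Prop :=
  complete /\ exists2 alpha, Pic alpha & very_ample alpha.

(* The monomials of degree alpha; there are finitely many when X is complete. *)
Definition monomials (alpha : Cl) : seq 'X_{1..r} :=
  enum_fset (fset_set [set b | degree b = alpha]%classic).

Definition hdim (alpha : Cl) : nat := size (monomials alpha).

Definition mon (alpha : Cl) (i : 'I_(hdim alpha)) : 'X_{1..r} :=
  nth 0%MM (monomials alpha) i.

(* S_alpha and T_alpha are both represented by coordinate vectors in the basis
   of monomials; T_alpha is identified with the dual of H^0(X, O(alpha)). *)
Definition to_mpoly (alpha : Cl) (v : 'rV[C]_(hdim alpha)) : {mpoly C[r]} :=
  \sum_i v 0 i *: 'X_[mon i].

Definition of_mpoly (alpha : Cl) (p : {mpoly C[r]}) : 'rV[C]_(hdim alpha) :=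
  \row_i p@_(mon i).

End ToricVariety.

Section Contraction.
Variables (K : fieldType) (r : nat).

(* The bilinear extension of x^a _| y^b = y^(b - a) if a <= b, 0 otherwise. *)
Definition contract (g F : {mpoly K[r]}) : {mpoly K[r]} :=
  \sum_(a <- msupp g) \sum_(b <- msupp F | (a <= b)%MM)
     (g@_a * F@_b) *: 'X_[b - a].

Lemma contractXX (i : 'I_r) (b : 'X_{1..r}) :
  contract 'X_i 'X_[b] = if (0 < b i)%N then 'X_[b - U_(i)] else 0.
Proof.
rewrite /contract !msuppX big_seq1 big_mkcond big_seq1 !mcoeffX !eqxx mulr1.
rewrite scale1r; congr (if _ then _ else _).
apply/mnm_lepP/idP => [/(_ i)|bi j]; first by rewrite mnm1E eqxx.
by rewrite mnm1E; case: eqP => // <-.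
Qed.

End Contraction.

Section Catalecticant.
Variables (R : realType) (n r : nat) (X : fan R n r).
Local Notation C := (complex R).

Definition catalecticant (alpha beta : Cl X) (F : 'rV[C]_(hdim alpha)) :
  'M[C]_(hdim beta, hdim (alpha - beta)) :=
  lin1_mx (fun h : 'rV[C]_(hdim beta) =>
    of_mpoly (alpha - beta) (contract (to_mpoly h) (to_mpoly F))).

(* Homogeneous coordinates on X: x lies outside the irrelevant locus iff its
   vanishing coordinates are rays of a common cone. *)
Definition cox_point (x : 'I_r -> C) : Prop :=
  exists2 s, s \in cones X & forall i, x i = 0 -> i \in s.

(* The image of X in P(H^0(X, O(alpha))^* ) = P(T_alpha): the point [x] is sent
   to evaluation at x, that is to \sum_b x^b y^b. *)
Definition embedded (alpha : Cl X) : set 'rV[C]_(hdim alpha) :=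
  [set v | exists2 x, cox_point x &
     v = \row_i \prod_j x j ^+ mon i j]%classic.

End Catalecticant.

Arguments embedded {R n r X} alpha _.
Arguments catalecticant {R n r X alpha} beta F.

(* Main.v *)
From HB Require Import structures.
Require Import Defs.
From mathcomp Require Import all_boot all_order all_algebra all_field.
From mathcomp Require Import perm finmap.
From mathcomp Require Import boolp classical_sets cardinality reals mpoly.
From mathcomp Require Import -(notations) constructive_ereal ereal.
From mathcomp.real_closed Require Import complex.

Set Implicit Arguments.
Unset Strict Implicit.
Unset Printing Implicit Defensive.

Import Order.TTheory GRing.Theory Num.Theory.
Local Open Scope ring_scope.

(** In monomial bases the catalecticant matrix of F has entry F_(a+c) in the
    row of x^a (of degree beta) and the column of y^c (of degree alpha - beta);
    see [catalecticantE].  Both bounds come from factoring this matrix.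

    Border rank.  For the point of the embedded variety with Cox coordinates x
    the entries are x^a x^c, so the matrix has rank at most 1, and by linearity
    it has rank at most l on the span of l points.  The minors of size greater
    than l are forms in the coordinates of F; they vanish on these spans, hence
    on their Zariski closure ([catalecticant_rank_secant]).

    Cactus rank.  Let Z be a zero-dimensional subscheme with algebra A and
    homogeneous coordinates w_b in A, one for each monomial x^b of degree alpha.
    If F lies in the span of Z, then F_b = phi(w_b) for a linear form phi on A
    ([zd_span_functional]).  When beta is Cartier, the line bundle of beta is
    trivial on Z, and a trivialization of it turns the multiplication of
    sections S_beta x S_(alpha-beta) -> S_alpha into a factorization
    w_(a+c) = u_a v_c in A ([zd_coord_splits]).  The matrix phi(u_a v_c) then
    factors through A, so its rank is at most dim A ([rank_bilinear_leq]).

    The trivialization is built by hand.  Let x^b0 be a monomial section.  The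
    rays i with b0_i = 0 span a cone of the fan, on which beta has a
    representative d that vanishes; very ampleness then writes a - d and
    c - (b0 - d) as sums of differences b - b0 with b of degree alpha.  This
    gives a binomial relation w_(a+c) w_b0^m = w_b0 * (product of w_b's), and so
    a factorization of w_(a+c) wherever w_b0 is invertible
    ([monomial_chart_relation], [splits_on_chart]).  As A is Artinian, it is cut by idempotents into pieces
    on each of which some w_b0 is invertible, because the w_b generate the unit
    ideal; the local factorizations add up ([splits_of_local]). *)

(** * Minors *)

Lemma exists_unit_minor (K : fieldType) m n (A : 'M[K]_(m, n)) :
  exists (f : 'I_(\rank A) -> 'I_m) (g : 'I_(\rank A) -> 'I_n),
    \det (mxsub f g A) != 0.
Proof.
have full : row_full (rowsub (maxrankfun A) A)^T.
  by rewrite /row_full mxrank_tr; exact: maxrowsub_free.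
exists (maxrankfun A), (fullrankfun full).
rewrite -unitfE -det_tr -unitmxE.
have := fullrowsub_unit full; congr (_ \in unitmx).
by apply/matrixP=> i j; rewrite !mxE.
Qed.

Lemma det_mulmx_thin (K : fieldType) (m l : nat)
    (A : 'M[K]_(m, l)) (B : 'M[K]_(l, m)) :
  (l < m)%N -> \det (A *m B) = 0.
Proof.
move=> ltlm; apply/eqP; apply: contraTT ltlm => det_n0.
rewrite -leqNgt -{1}(mxrank_unit (_ : A *m B \in unitmx)).
  by rewrite (leq_trans (mxrankM_maxl A B)) ?rank_leq_col.
by rewrite unitmxE unitfE.
Qed.

Lemma det_dhomog (R : comNzRingType) (h n d : nat) (A : 'M[{mpoly R[h]}]_n) :
  (forall i j, A i j \is d.-homog) -> \det A \is (d * n).-homog.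
Proof.
move=> homA; rewrite rpred_sum // => s _; rewrite mulr_sign.
have homP : \prod_i A i (s i) \is (d * n).-homog.
  have -> : (d * n = \sum_(i < n) d)%N by rewrite sum_nat_const card_ord mulnC.
  elim/big_rec2: _ => [|i p q _ hp]; first exact: dhomog1.
  exact: dhomogM hp.
by case: ifP; rewrite ?rpredN.
Qed.

(** * Splitting over a finite-dimensional commutative algebra *)

(** The ideals x^N A form a decreasing chain of subspaces of A, which is
    stationary by finite dimension. *)
Lemma power_stabilizes (K : fieldType) (A : falgType K) (x : A) :
  exists N z, x ^+ N = x ^+ N.+1 * z.
Proof.
pose V N := limg (amull (x ^+ N)).
have leV N : (V N.+1 <= V N)%VS.
  apply/subvP=> _ /memv_imgP[a _ ->]; apply/memv_imgP; exists (x * a).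
    by rewrite memvf.
  by rewrite !lfunE /= exprSr mulrA.
apply: contrapT => noN.
suff dimV N : (\dim (V N) + N <= \dim {:A})%N.
  by have := dimV (\dim {:A}).+1; rewrite addnS ltnNge leq_addl.
elim: N => [|N IH]; first by rewrite addn0 dimvS ?subvf.
apply: leq_trans IH; rewrite addnS -addSn leq_add2r.
rewrite ltn_neqAle dimvS // andbT.
apply: contra_notN noN => eqdim.
have /eqP eqV : V N.+1 == V N by rewrite eqEdim leV (eqP eqdim) leqnn.
have : x ^+ N \in V N.+1.
  by rewrite eqV; apply/memv_imgP; exists 1; rewrite ?memvf // lfunE /= mulr1.
by case/memv_imgP=> z _ xN; exists N, z; rewrite {1}xN lfunE.
Qed.

Section Splitting.
Variable A : comPzRingType.
Implicit Types e g x y : A.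

(** The projector e of the Fitting decomposition for multiplication by x: x is
    invertible on the ideal of e, with inverse y, and nilpotent on that of
    1 - e. *)
Lemma fitting_idempotent x N z : x ^+ N = x ^+ N.+1 * z ->
  exists e y, [/\ e * e = e, x * y = e & (1 - e) * x ^+ N = 0].
Proof.
move=> xN; have xNk k : x ^+ N * (x * z) ^+ k = x ^+ N.
  by elim: k => [|k IH]; rewrite ?mulr1 // exprS mulrA mulrA -exprSr -xN IH.
exists ((x * z) ^+ N.+1), (z * (x * z) ^+ N); split.
- rewrite {1 3}exprMn exprS -!mulrA; congr (x * _).
  by rewrite mulrCA xNk mulrC.
- by rewrite mulrA -exprS.
- by rewrite mulrBl mul1r mulrC xNk subrr.
Qed.

(** If g were nonzero, multiplying it in turn by the highest power of each w k
    that does not kill it would give a nonzero multiple of g killed by all the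
    w k, hence by 1. *)
Lemma nilpotent_on_cover h (w c : 'I_h -> A) g :
  \sum_k c k * w k = 1 -> (forall k, exists N, g * w k ^+ N = 0) -> g = 0.
Proof.
move=> unimod nil; apply: contrapT => g_n0.
have [z gz_n0 gzw] : exists2 z, g * z <> 0 &
    forall k, k \in enum 'I_h -> g * z * w k = 0.
  elim: (enum _) => [|k s [z gz_n0 gzw]]; first by exists 1; rewrite ?mulr1.
  have [N gN] : exists N, g * z * w k ^+ N = 0.
    by have [N gN] := nil k; exists N; rewrite mulrAC gN mul0r.
  elim: N => [|N IH] in gN *; first by rewrite mulr1 in gN.
  have [/IH//|gN'] := EM (g * z * w k ^+ N = 0).
  exists (z * w k ^+ N); first by rewrite mulrA.
  move=> k'; rewrite inE => /predU1P[->|/gzw gzk'].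
    by rewrite -!mulrA -exprSr mulrA.
  by rewrite mulrA mulrAC gzk' mul0r.
apply: gz_n0; rewrite -[LHS]mulr1 -unimod mulr_sumr big1 // => k _.
by rewrite mulrCA gzw ?mulr0 // mem_enum.
Qed.

Variables (I J : Type) (t : I -> J -> A).

(** In the application t i j is the coordinate of the product of the i-th section
    of beta and the j-th section of alpha - beta; u and v are the values of these
    sections under a trivialization of beta over the open and closed subscheme
    of Spec A where e = 1. *)
Definition splits_on e := e * e = e /\
  exists (u : I -> A) (v : J -> A), forall i j, e * t i j = u i * v j.

(** The open and closed subscheme defined by e + (1 - e) f is the disjoint union
    of those of e and of (1 - e) f, so trivializations can be glued. *)
Lemma splits_on_join e f :
  splits_on e -> splits_on f -> splits_on (e + (1 - e) * f).
Proof.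
move=> [ee [u [v euv]]] [ff [u' [v' fuv]]].
have e1 : e * (1 - e) = 0 by rewrite mulrBr mulr1 ee subrr.
have e11 : (1 - e) * (1 - e) = 1 - e.
  by rewrite {1}mulrBl mul1r e1 subr0.
split.
  rewrite mulrDl !mulrDr ee !mulrA e1 mul0r addr0 [_ * f * e]mulrAC.
  by rewrite [(1 - e) * e]mulrC e1 mul0r add0r [_ * f * _]mulrAC e11 -mulrA ff.
exists (fun i => e * u i + (1 - e) * u' i), (fun j => e * v j + (1 - e) * v' j).
move=> i j; rewrite mulrDl -mulrA fuv -{1}ee -mulrA euv.
move: (1 - e) e1 e11 => e' e1 e11; rewrite mulrDl !mulrDr.
rewrite [e * u i * (e * _)]mulrACA [e * u i * (e' * _)]mulrACA.
rewrite [e' * u' i * (e * _)]mulrACA [e' * u' i * (e' * _)]mulrACA.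
by rewrite [e' * e]mulrC e1 !mul0r addr0 add0r ee e11.
Qed.

(** The Fitting idempotents of the w k cover Spec A: on the complement of their
    join every w k is nilpotent, while the w k generate the unit ideal. *)
Lemma splits_of_local h (w c : 'I_h -> A) :
  \sum_k c k * w k = 1 ->
  (forall k, exists N z, w k ^+ N = w k ^+ N.+1 * z) ->
  (forall k e y, e * e = e -> w k * y = e -> splits_on e) ->
  exists (u : I -> A) (v : J -> A), forall i j, t i j = u i * v j.
Proof.
move=> unimod fitting loc.
have [e [ee [u [v euv]]] cover] : exists2 e, splits_on e &
    forall k, k \in enum 'I_h -> exists N, (1 - e) * w k ^+ N = 0.
  elim: (enum _) => [|k s [e spl_e nil_e]].
    exists 0 => //; split; first by rewrite mul0r.
    by exists (fun=> 0), (fun=> 0) => i j; rewrite !mul0r.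
  have [N [z wN]] := fitting k.
  have [f [y [ff wy nil_f]]] := fitting_idempotent wN.
  exists (e + (1 - e) * f).
    by apply: splits_on_join => //; exact: loc ff wy.
  have -> : 1 - (e + (1 - e) * f) = (1 - e) * (1 - f).
    by rewrite opprD addrA mulrBr mulr1.
  move=> k'; rewrite inE => /predU1P[->|/nil_e[M nil]].
    by exists N; rewrite -mulrA nil_f mulr0.
  by exists M; rewrite mulrAC nil mul0r.
have e1 : 1 - e = 0.
  by apply: (nilpotent_on_cover unimod) => k; apply: cover; rewrite mem_enum.
exists u, v => i j; rewrite -euv.
by move/eqP: e1; rewrite subr_eq0 => /eqP <-; rewrite mul1r.
Qed.

(** Here u i and v j are the products over s1 i and s2 j dehomogenized by w k,
    with one factor w k put back into v because t i j has degree one in w. *)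
Lemma splits_on_chart h (w : 'I_h -> A) k e y
    (s1 : I -> seq 'I_h) (s2 : J -> seq 'I_h) :
  e * e = e -> w k * y = e ->
  (forall i j, t i j * w k ^+ (size (s1 i) + size (s2 j)) =
     w k * (\prod_(b <- s1 i) w b * \prod_(b <- s2 j) w b)) ->
  splits_on e.
Proof.
move=> ee wy rel; split=> //.
exists (fun i => e * y ^+ size (s1 i) * \prod_(b <- s1 i) w b).
exists (fun j => w k * y ^+ size (s2 j) * \prod_(b <- s2 j) w b) => i j.
rewrite [in RHS]mulrACA [e * _ * (w k * _)]mulrACA -exprD.
have eM m : e * e ^+ m = e.
  by elim: m => [|m IH]; rewrite ?mulr1 // exprS mulrA ee.
rewrite -{1}(eM (size (s1 i) + size (s2 j))%N) -{2}wy exprMn.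
rewrite -!mulrA; congr (e * _).
by rewrite [RHS]mulrCA -rel mulrCA [t i j * _]mulrC mulrCA.
Qed.

End Splitting.

Lemma mmap1_sum h (A : nzRingType) (x : 'I_h -> A) I (s : seq I)
    (m : I -> 'X_{1..h}) :
  (forall i a, GRing.comm a (x i)) ->
  mmap1 x (\sum_(k <- s) m k)%MM = \prod_(k <- s) mmap1 x (m k).
Proof.
move=> comm_x; elim: s => [|k s IH]; first by rewrite !big_nil mmap11.
by rewrite !big_cons commr_mmap1_M // IH.
Qed.

(** * Monomials of a given degree and the catalecticant matrix *)

Section Monomials.
Variables (R : realType) (n r : nat) (X : fan R n r).
Implicit Types (alpha beta : Cl X) (b : 'X_{1..r}).
Local Notation C := (complex R).

Lemma div_class_eq (a b : 'rV[int]_r) :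
  (div_class X a = div_class X b) <-> (a - b \in principal (rays X)).
Proof. by rewrite Quotient.idealrBE; split=> [e|/eqP //]; exact/eqP. Qed.

Lemma div_classD (a b : 'rV[int]_r) :
  div_class X (a + b) = div_class X a + div_class X b.
Proof. exact: raddfD. Qed.

Lemma div_classB (a b : 'rV[int]_r) :
  div_class X (a - b) = div_class X a - div_class X b.
Proof. exact: raddfB. Qed.

Lemma mon_divD (a b : 'X_{1..r}) : mon_div (a + b) = mon_div a + mon_div b.
Proof. by apply/rowP=> i; rewrite !mxE mnmDE PoszD. Qed.

Lemma mon_div_sum I (s : seq I) (m : I -> 'X_{1..r}) :
  mon_div (\sum_(k <- s) m k)%MM = \sum_(k <- s) mon_div (m k).
Proof.
elim: s => [|k s IH]; last by rewrite !big_cons mon_divD IH.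
by rewrite !big_nil; apply/rowP=> i; rewrite !mxE mnm0E.
Qed.

Lemma mon_div_inj : injective (@mon_div r).
Proof.
by move=> a b /rowP eq_ab; apply/mnmP=> i; have := eq_ab i; rewrite !mxE => -[].
Qed.

Lemma degreeD (a b : 'X_{1..r}) : degree X (a + b) = degree X a + degree X b.
Proof. by rewrite /degree mon_divD div_classD. Qed.

(** An infinite set of monomials would be enumerated by the empty sequence, so a
    single index certifies that the enumeration of [monomials] is faithful. *)
Lemma finite_monomials alpha (i : 'I_(hdim alpha)) :
  finite_set [set b | degree X b = alpha]%classic.
Proof.
case: i => i; rewrite /hdim /monomials /fset_set.
by case: pselect.
Qed.

Lemma mem_monomials alpha (i : 'I_(hdim alpha)) b :
  (b \in monomials alpha) = (degree X b == alpha).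
Proof.
rewrite [LHS](in_fset_set (finite_monomials i)).
by apply/idP/eqP; rewrite inE.
Qed.

Lemma degree_mon alpha (i : 'I_(hdim alpha)) : degree X (mon i) = alpha.
Proof. by apply/eqP; rewrite -(mem_monomials i) mem_nth. Qed.

Lemma mon_inj alpha : injective (@mon _ _ _ X alpha).
Proof.
move=> i j /eqP; rewrite nth_uniq ?ltn_ord ?fset_uniq // => /eqP.
exact: val_inj.
Qed.

Lemma monP alpha (i : 'I_(hdim alpha)) b :
  degree X b = alpha -> exists k : 'I_(hdim alpha), mon k = b.
Proof.
move=> /eqP; rewrite -(mem_monomials i) => b_mon.
have lt_b : (index b (monomials alpha) < hdim alpha)%N by rewrite index_mem.
by exists (Ordinal lt_b); rewrite /mon nth_index.
Qed.

(** Contraction by x^a sends y^b to y^(b - a), so only b = a + c contributes to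
    the coefficient of y^c. *)
Lemma catalecticantE alpha beta (F : 'rV[C]_(hdim alpha)) i j k :
  mon k = (mon i + mon j)%MM -> catalecticant beta F i j = F 0 k.
Proof.
move=> mon_k; rewrite mxE mxE.
have -> : to_mpoly (delta_mx 0 i : 'rV[C]_(hdim beta)) = 'X_[mon i].
  rewrite /to_mpoly (bigD1 i) //= mxE !eqxx scale1r big1 ?addr0 // => i' ne_i.
  by rewrite mxE (negbTE ne_i) andbF scale0r.
rewrite /Defs.contract msuppX big_seq1 raddf_sum /=.
under eq_bigr => b le_b do rewrite mcoeffX eqxx mul1r mcoeffZ mcoeffX.
have -> : F 0 k = (to_mpoly F)@_(mon k).
  rewrite /to_mpoly raddf_sum (bigD1 k) //= mcoeffZ mcoeffX eqxx mulr1.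
  rewrite big1 ?addr0 // => k' ne_k; rewrite mcoeffZ mcoeffX.
  by rewrite (inj_eq (@mon_inj _)) (negbTE ne_k) mulr0.
have eq_b b : (mon i <= b)%MM ->
    ((b - mon i)%MM == mon j) = (b == mon k).
  by move=> le_b; rewrite mon_k -{2}(submK le_b) addmC eqm_add2l.
under eq_bigr => b le_b do rewrite eq_b //.
have [k_supp|k_nsupp] := boolP (mon k \in msupp (to_mpoly F)).
  rewrite big_mkcond (bigD1_seq (mon k)) ?msupp_uniq //= eqxx mulr1.
  have -> : (mon i <= mon k)%MM by rewrite mon_k lem_addr ?lemm.
  by rewrite big1 ?addr0 // => b /negbTE ->; rewrite mulr0 if_same.
rewrite (memN_msupp_eq0 k_nsupp) big_seq_cond big1 // => b /andP[b_supp _].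
have [eq_bk|_] := eqVneq b (mon k); last by rewrite mulr0.
by rewrite -eq_bk b_supp in k_nsupp.
Qed.

Lemma mon_sum_index alpha beta (k0 : 'I_(hdim alpha)) :
  exists t : 'I_(hdim beta) -> 'I_(hdim (alpha - beta)) -> 'I_(hdim alpha),
    forall i j, mon (t i j) = (mon i + mon j)%MM.
Proof.
have h i j : exists k : 'I_(hdim alpha),
    mon k = (mon (i : 'I_(hdim beta)) + mon (j : 'I_(hdim (alpha - beta))))%MM.
  by apply: (monP k0); rewrite degreeD !degree_mon addrC subrK.
exists (fun i j => projT1 (cid (h i j))) => i j; exact: projT2 (cid (h i j)).
Qed.

(** * Monomial relations on the embedded variety *)

(** On the affine chart of s a Cartier divisor is the divisor of a character;
    subtracting it does not change the class. *)
Lemma Pic_trivial_on_cone beta s : Pic beta -> s \in cones X ->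
  exists2 d : 'rV[int]_r, div_class X d = beta & forall i, i \in s -> d 0 i = 0.
Proof.
move=> [a cartier_a ->] /cartier_a[m am].
exists (a - div_character (rays X) m); last first.
  by move=> i /am am_i; rewrite mxE [X in _ + X]mxE am_i subrr.
apply/div_class_eq; rewrite addrAC subrr add0r rpredN.
by apply/asboolP; exists m.
Qed.

Lemma very_ample_chart alpha (k0 : 'I_(hdim alpha)) (c : 'rV[int]_r) :
  very_ample alpha -> c \in principal (rays X) ->
  (forall i, mon k0 i = 0%N -> 0 <= c 0 i) ->
  exists s : seq 'I_(hdim alpha),
    c = \sum_(k <- s) (mon_div (mon k) - mon_div (mon k0)).
Proof.
move=> [_ ample] c_pr c_ge0.
have [_ /(_ c c_pr c_ge0)[bs deg_bs ->]] := ample _ (degree_mon k0).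
have [s ->] : exists s : seq 'I_(hdim alpha), bs = [seq mon k | k <- s].
  elim: bs deg_bs => [|b bs IH] deg_bs; first by exists [::].
  have [|s ->] := IH; first by move=> b' b'_bs; rewrite deg_bs // inE b'_bs orbT.
  have [k <-] := monP k0 (deg_bs b (mem_head _ _)).
  by exists (k :: s).
by exists s; rewrite big_map.
Qed.

(** With d representing beta and zero where b0 = mon k0 is zero, the Laurent
    monomials x^(a - d) and x^(c - (b0 - d)) have degree 0 and are regular on the
    chart x^b0 <> 0, so they are products of ratios x^b / x^b0.  Multiplying the
    two gives x^(a + c) / x^b0. *)
Lemma monomial_chart_relation alpha beta (k0 : 'I_(hdim alpha)) :
  very_ample alpha -> Pic beta ->
  exists (s1 : 'I_(hdim beta) -> seq 'I_(hdim alpha))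
         (s2 : 'I_(hdim (alpha - beta)) -> seq 'I_(hdim alpha)),
    forall i j (k : 'I_(hdim alpha)), mon k = (mon i + mon j)%MM ->
    (\sum_(l <- k :: nseq (size (s1 i) + size (s2 j)) k0) mon l)%MM =
    (\sum_(l <- k0 :: s1 i ++ s2 j) mon l)%MM.
Proof.
move=> ample pic_beta.
have [cone0 _] := ample.2 _ (degree_mon k0).
have [d d_beta d0] := Pic_trivial_on_cone pic_beta cone0.
have {}d0 i : mon k0 i = 0%N -> d 0 i = 0.
  by move=> k0i; rewrite d0 // inE k0i.
have h1 (i : 'I_(hdim beta)) : exists s : seq 'I_(hdim alpha),
    mon_div (mon i) - d = \sum_(k <- s) (mon_div (mon k) - mon_div (mon k0)).
  apply: very_ample_chart => // [|l k0l].
    by apply/div_class_eq; rewrite d_beta; exact: degree_mon.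
  by rewrite !mxE d0 // subr0.
have h2 (j : 'I_(hdim (alpha - beta))) : exists s : seq 'I_(hdim alpha),
    mon_div (mon j) - (mon_div (mon k0) - d) =
    \sum_(k <- s) (mon_div (mon k) - mon_div (mon k0)).
  apply: very_ample_chart => // [|l k0l].
    apply/div_class_eq; rewrite div_classB d_beta.
    by rewrite -![div_class X (mon_div _)]/(degree X _) !degree_mon.
  by rewrite !mxE d0 // k0l !subr0.
exists (fun i => projT1 (cid (h1 i))), (fun j => projT1 (cid (h2 j))) => i j k mk.
case: (cid (h1 i)) (cid (h2 j)) => s1 /= e1 [s2 /= e2].
apply: mon_div_inj; rewrite !mon_div_sum !big_cons big_cat /= mk mon_divD.
have -> : \sum_(l <- nseq (size s1 + size s2) k0) mon_div (mon l) =
    mon_div (mon k0) *+ (size s1 + size s2).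
  by rewrite big_nseq iter_addr addr0.
move: e1 e2; rewrite !sumrB !big_const_seq !count_predT !iter_addr !addr0.
set P := \sum_(l <- s1) _; set Q := \sum_(l <- s2) _ => e1 e2.
(* the divisor d cancels between the two representations *)
have e : mon_div (mon i) + mon_div (mon j) - mon_div (mon k0) =
    P + Q - (mon_div (mon k0) *+ (size s1 + size s2)).
  by rewrite mulrnDr opprD addrACA -e1 -e2 addrACA -opprD [d + _]addrC subrK.
by apply/eqP; rewrite eq_sym -subr_eq -addrA -e addrC subrK.
Qed.

(** The difference of the two monomials in the coordinates is a form that
    vanishes at every point given by Cox coordinates. *)
Lemma embedded_monomial_relation alpha
    (Z : zero_dim_subscheme (embedded alpha)) (s t : seq 'I_(hdim alpha)) :
  size s = size t ->
  (\sum_(k <- s) mon k = \sum_(k <- t) mon k)%MM ->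
  \prod_(k <- s) zd_coord Z k = \prod_(k <- t) zd_coord Z k.
Proof.
move=> eq_size eq_sum.
have mdegU (u : seq 'I_(hdim alpha)) : mdeg (\sum_(k <- u) U_(k))%MM = size u.
  by rewrite mdeg_sum (eq_bigr (fun=> 1%N)) ?sum1_size // => k _; rewrite mdeg1.
pose f : {mpoly C[hdim alpha]} :=
  'X_[\sum_(k <- s) U_(k)] - 'X_[\sum_(k <- t) U_(k)].
have homf : f \is (size s).-homog.
  by rewrite rpredB // dhomogX /= mdegU // eq_size.
have vanf : vanishes_on (embedded alpha) f.
  move=> y [x _ ->]; rewrite mevalB !mevalX.
  set y0 := \row__ _.
  have evE (u : seq 'I_(hdim alpha)) :
      mmap1 (y0 0) (\sum_(k <- u) U_(k))%MM = mmap1 x (\sum_(k <- u) mon k)%MM.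
    rewrite !mmap1_sum; try by move=> ? ?; exact: mulrC.
    by apply: eq_bigr => k _; rewrite mmap1U mxE.
  by rewrite -!/(mmap1 (y0 0) _) !evE eq_sum subrr.
have := zd_subscheme Z homf vanf.
rewrite mmapB !mmapX !mmap1_sum; try by move=> ? ?; exact: zd_comm.
move/eqP; rewrite subr_eq0 => /eqP.
by under eq_bigr do rewrite mmap1U; under [in RHS]eq_bigr do rewrite mmap1U.
Qed.

End Monomials.

(** * The two rank bounds *)

Section RankBounds.
Variables (R : realType) (n r : nat) (X : fan R n r).
Local Notation C := (complex R).

Lemma catalecticant_rank_secant (alpha beta : Cl X) l (F : 'rV[C]_(hdim alpha)) :
  secant (embedded alpha) l F -> (\rank (catalecticant beta F) <= l)%N.
Proof.
move=> [F_n0 closed_F].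
have [k0 _] : exists k, F 0 k != 0 by apply/rV0Pn.
have [t mon_t] := mon_sum_index beta k0.
have [f [g]] := exists_unit_minor (catalecticant beta F).
set p := \rank _ in f g *; rewrite leqNgt => minor_n0; apply/negP => lt_lp.
(* the nonzero minor of F, as a form in the coordinates of F *)
pose M : 'M[{mpoly C[hdim alpha]}]_p := \matrix_(i, j) 'X_(t (f i) (g j)).
have evM (v : 'rV[C]_(hdim alpha)) :
    (\det M).@[v 0] = \det (mxsub f g (catalecticant beta v)).
  rewrite -(det_map_mx (meval (v 0))); congr (\det _).
  apply/matrixP=> i j; rewrite mxE [M i j]mxE /= mevalXU [RHS]mxE.
  by rewrite (catalecticantE _ (mon_t _ _)).
have homM : \det M \is (1 * p).-homog.
  by apply: det_dhomog => i j; rewrite mxE dhomogX /= mdeg1.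
have /negP := minor_n0; apply; apply/eqP; rewrite -evM.
apply: closed_F homM _ => v [_ [x [x_emb /submxP[c ->]]]].
rewrite evM.
have [a aE] : exists a : 'I_l -> 'I_r -> C, forall i,
    x i = \row_k \prod_j a i j ^+ mon k j.
  have h i : exists a : 'I_r -> C, x i = \row_k \prod_j a j ^+ mon k j.
    by have [a _ ->] := x_emb i; exists a.
  by exists (fun i => projT1 (cid (h i))) => i; exact: projT2 (cid (h i)).
(* on a span of l points the minor is that of a sum of l matrices of rank 1 *)
rewrite [X in \det X](_ : _ =
  (\matrix_(i < p, m < l) (c 0 m * mmap1 (a m) (mon (f i)))) *m
  (\matrix_(m < l, j < p) mmap1 (a m) (mon (g j)))); first exact: det_mulmx_thin.
apply/matrixP=> i j; rewrite mxE (catalecticantE _ (mon_t _ _)) !mxE.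
apply: eq_bigr => m _; rewrite !mxE aE mxE -mulrA; congr (_ * _).
rewrite -[LHS]/(mmap1 (a m) _) mon_t commr_mmap1_M // => ? ?; exact: mulrC.
Qed.

(** The linear span of Z is the row space of the matrix of the coordinates of Z
    in a basis of A; phi is the vector of coefficients of F on its rows. *)
Lemma zd_span_functional (alpha : Cl X) (Z : zero_dim_subscheme (embedded alpha))
    (F : 'rV[C]_(hdim alpha)) :
  zd_span Z F -> exists phi : 'rV[C]_(\dim {:zd_alg Z}),
    forall k, F 0 k = \sum_l phi 0 l * coord (vbasis {:zd_alg Z}) l (zd_coord Z k).
Proof.
move=> [_ spanF].
pose L : 'M[C]_(\dim {:zd_alg Z}, hdim alpha) :=
  \matrix_(l, k) coord (vbasis {:zd_alg Z}) l (zd_coord Z k).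
have : (F <= <<L>>)%MS.
  apply: spanF => c Lc0; rewrite [LHS](coord_vbasis (memvf _)).
  have {}Lc0 : L *m c = 0.
    have /submxP[D ->] : (L <= <<L>>)%MS by rewrite genmxE.
    by rewrite -mulmxA Lc0 mulmx0.
  rewrite big1 // => l _; rewrite linear_sum.
  have := congr1 (fun v : 'cV_ _ => v l 0) Lc0; rewrite !mxE => Lcl.
  rewrite [X in X *: _](_ : _ = 0) ?scale0r // -[RHS]Lcl.
  by apply: eq_bigr => k _; rewrite linearZ mxE mulrC.
rewrite genmxE => /submxP[phi ->]; exists phi => k.
by rewrite mxE; apply: eq_bigr => l _; rewrite mxE.
Qed.

(** The line bundle of beta is trivial on Z, because Z is the spectrum of an
    Artinian algebra; u and v are the restrictions to Z of the monomial sections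
    of beta and alpha - beta in a trivialization. *)
Lemma zd_coord_splits (alpha beta : Cl X) (Z : zero_dim_subscheme (embedded alpha))
    (t : 'I_(hdim beta) -> 'I_(hdim (alpha - beta)) -> 'I_(hdim alpha)) :
  very_ample alpha -> Pic beta ->
  (forall i j, mon (t i j) = (mon i + mon j)%MM) ->
  exists (u : 'I_(hdim beta) -> zd_alg Z)
         (v : 'I_(hdim (alpha - beta)) -> zd_alg Z),
    forall i j, zd_coord Z (t i j) = u i * v j.
Proof.
move=> ample pic mon_t.
(* the algebra of Z with its commutativity made part of the structure *)
pose A : comPzRingType :=
  HB.pack (zd_alg Z : Type) (GRing.PzRing.on (zd_alg Z))
    (GRing.PzRing_hasCommutativeMul.Build (zd_alg Z) (@zd_comm _ _ _ Z)).
have [c unimod] := zd_unimodular Z.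
apply: (@splits_of_local A _ _ (fun i j => zd_coord Z (t i j)) _ _ _ unimod).
  by move=> k; exact: (power_stabilizes (zd_coord Z k)).
move=> k e y ee wy.
have [s1 [s2 rel]] := monomial_chart_relation k ample pic.
apply: (splits_on_chart (s1 := s1) (s2 := s2) ee wy) => i j.
have := embedded_monomial_relation Z _ (rel i j (t i j) (mon_t i j)).
rewrite !big_cons big_cat /= big_nseq iter_mulr_1; apply.
by rewrite /= size_nseq size_cat.
Qed.

(** The matrix is that of the composite K^p -> A -> (K^q)^*, where the second map
    sends a to the values phi(a v_j). *)
Lemma rank_bilinear_leq (K : fieldType) (A : falgType K) p q (M : 'M[K]_(p, q))
    (phi : 'rV[K]_(\dim {:A})) (u : 'I_p -> A) (v : 'I_q -> A) :
  (forall i j, M i j = \sum_l phi 0 l * coord (vbasis {:A}) l (u i * v j)) ->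
  (\rank M <= \dim {:A})%N.
Proof.
move=> ME; set b := vbasis {:A} in ME.
have -> : M = (\matrix_(i, m) coord b m (u i)) *m
    (\matrix_(m, j) \sum_l phi 0 l * coord b l (b`_m * v j)).
  apply/matrixP=> i j; rewrite ME mxE.
  under [RHS]eq_bigr do rewrite !mxE mulr_sumr.
  rewrite exchange_big; apply: eq_bigr => l _ /=.
  rewrite {1}[u i](coord_vbasis (memvf _)) mulr_suml linear_sum mulr_sumr.
  by apply: eq_bigr => m _; rewrite -scalerAl linearZ mulrCA.
exact: leq_trans (mxrankM_maxl _ _) (rank_leq_col _).
Qed.

Lemma catalecticant_rank_zd_span (alpha beta : Cl X)
    (Z : zero_dim_subscheme (embedded alpha)) (F : 'rV[C]_(hdim alpha)) :
  very_ample alpha -> Pic beta -> zd_span Z F ->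
  (\rank (catalecticant beta F) <= zd_length Z)%N.
Proof.
move=> ample pic spanF.
have [k0 _] : exists k, F 0 k != 0 by apply/rV0Pn; case: spanF.
have [t mon_t] := mon_sum_index beta k0.
have [phi phiF] := zd_span_functional spanF.
have [u [v uv]] := zd_coord_splits Z ample pic mon_t.
apply: (rank_bilinear_leq (phi := phi) (u := u) (v := v)) => i j.
by rewrite (catalecticantE _ (mon_t i j)) phiF uv.
Qed.

End RankBounds.

Lemma le_nat_min (R : realType) (P : set nat) p :
  (forall l, P l -> (p <= l)%N) -> (EFin p%:R <= nat_min R P)%O.
Proof.
move=> le_p; apply: le_ereal_inf_tmp => _ [l Pl <-].
by rewrite lee_fin ler_nat le_p.
Qed.

Theorem theorem1p2 (R : realType) (n r : nat) (X : fan R n r)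
    (alpha : Cl X) (F : 'rV[complex R]_(hdim alpha)) :
  Qfactorial X -> projective X ->
  Pic alpha -> very_ample alpha -> F != 0 ->
  (forall beta : Cl X,
     (EFin (\rank (catalecticant beta F))%:R
        <= border_rank R (embedded alpha) F)%O) /\
  (forall beta : Cl X, Pic beta ->
     (EFin (\rank (catalecticant beta F))%:R
        <= cactus_rank R (embedded alpha) F)%O).
Proof.
move=> _ _ _ ample _; split=> [beta|beta pic_beta]; apply: le_nat_min => l.
  by move=> [_ secF]; exact: catalecticant_rank_secant secF.
by move=> [Z [<- spanF]]; exact: catalecticant_rank_zd_span.
Qed.
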